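(* Let $d\ge 3$, $G=SO(d)$, $f(x)=x$ and $\Omega_i=0$ for all $i$, and let $\Gamma$ be a symmetric circulant graph on $n$ vertices with weights $\gamma_k\ge 0$, not all zero. (1) (Nearest neighbor.) If $\Gamma$ has bandwidth $K=1$ and $1<n/4$, then $\Gamma$ supports $1$-twists. (2) (Strict bandwidth.) Suppose $\Gamma$ has strict bandwidth $K$, $1\le K\le \lfloor n/2\rfloor$. If $K$ does not divide $n$, then the $1$-twist is linearly unstable, and thus $\Gamma$ does not support $1$-twists. If $K$ divides $n$ and $K<n/4$, then the $1$-twist is linearly stable. (3) (Strong local coupling.) Let $1\le K<n/4$. There is a piecewise linear function $G_{K,n}(\gamma_2,\dots,\gamma_K)$ such that every symmetric circulant graph on $n$ vertices of bandwidth $K$ whose weights satisfy $\gamma_1>G_{K,n}(\gamma_2,\dots,\gamma_K)$ supports $1$-twists.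
   Context: Quantum Kuramoto system on $G=SO(d)$ with $f(x)=x$, $\Omega=0$: for $X=(X_1,\dots,X_n)\in SO(d)^n$, $$X_i'X_i^{-1}=\frac12\sum_{j=1}^n\gamma_{ij}\bigl(X_jX_i^{-1}-X_iX_j^{-1}\bigr),$$ where $\gamma_{ij}=\gamma_{ji}\ge 0$ are the edge weights of an undirected weighted graph $\Gamma$ on $n$ vertices. The graph $\Gamma$ is symmetric circulant if $\gamma_{ij}$ depends only on the cyclic distance $k=\min(|i-j|,n-|i-j|)$; one writes $\gamma_k$ for this common value, $1\le k\le\lfloor n/2\rfloor$. It has bandwidth $K$ if $\gamma_k=0$ for all $k>K$, and strict bandwidth $K$ if $\gamma_k=0$ for all $k\ne K$. Let $T\in SO(d)$ be an element which in some orthonormal basis of $\mathbb R^d$ is the rotation by angle $2\pi/n$ in the plane of the first two basis vectors and the identity on the remaining ones. The configuration $Y_i=T^i$, $i=1,\dots,n$, is called a (single) $1$-twist; it is a fixed point of the system. The linearization at a fixed point $Y$ (in coordinates $X_i=Y_i\exp(Q_i)$, $Q_i\in\mathfrak{so}(d)$) is $Q'=\mathcal L_YQ$ with $$(\mathcal L_YQ)_i=\frac12\sum_{j=1}^n\gamma_{ij}\bigl(Y_i^{-1}Y_j(Q_j-Q_i)+(Q_j-Q_i)Y_j^{-1}Y_i\bigr),\qquad Q\in\mathfrak{so}(d)^n.$$ For a twist solution all eigenvalues of $\mathcal L_Y$ are real. The solution is called linearly stable if no eigenvalue of $\mathcal L_Y$ is positive, and linearly unstable if some eigenvalue is positive.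 The graph supports $1$-twists if the $1$-twist is linearly stable. *)

(* Defs.v *)
From mathcomp Require Import all_boot all_order all_algebra.
From mathcomp Require Import reals trigo.

Set Implicit Arguments.
Unset Strict Implicit.
Unset Printing Implicit Defensive.

Import Order.TTheory GRing.Theory Num.Theory.
Local Open Scope ring_scope.

Section Graphs.
Context {R : realType}.

Definition weighted_graph n (w : 'M[R]_n) : Prop :=
  (forall i j, w i j = w j i) /\ (forall i j, 0 <= w i j).

(* The inner expression is |i - j|, written with truncated subtraction. *)
Definition cyclic_dist n (i j : 'I_n) : nat :=
  let k := ((i - j) + (j - i))%N in minn k (n - k).

(* [gamma k] is the common weight of the pairs at cyclic distance [k]; only its
   values for 1 <= k <= n./2 are meaningful, and loops have no effect on the
   dynamics. *)
Definition symmetric_circulant n (w : 'M[R]_n) (gamma : nat -> R) : Prop :=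
  weighted_graph w /\
  forall i j : 'I_n, i != j -> w i j = gamma (cyclic_dist i j).

Definition not_all_zero (n : nat) (gamma : nat -> R) : Prop :=
  exists k : nat, (1 <= k <= n./2)%N /\ gamma k != 0.

Definition bandwidth (n : nat) (gamma : nat -> R) (K : nat) : Prop :=
  forall k : nat, (1 <= k <= n./2)%N -> (K < k)%N -> gamma k = 0.

Definition strict_bandwidth (n : nat) (gamma : nat -> R) (K : nat) : Prop :=
  forall k : nat, (1 <= k <= n./2)%N -> k != K -> gamma k = 0.

End Graphs.

Section Twists.
Context {R : realType}.

Definition orthogonal_mx d (A : 'M[R]_d) : Prop := A^T *m A = 1%:M.

Definition special_orthogonal d (A : 'M[R]_d) : Prop :=
  orthogonal_mx A /\ \det A = 1.

Definition skew_symmetric d (A : 'M[R]_d) : Prop := A^T = - A.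

Definition plane_rotation d (t : R) : 'M[R]_d :=
  \matrix_(i, j)
    match val i, val j with
    | 0%N, 0%N => cos t
    | 0%N, 1%N => - sin t
    | 1%N, 0%N => sin t
    | 1%N, 1%N => cos t
    | _, _ => (i == j)%:R
    end.

(* The columns of [P] form the orthonormal basis in which [T] is the rotation
   by 2 pi / n. *)
Definition twist_generator (n d : nat) (T : 'M[R]_d) : Prop :=
  special_orthogonal T /\
  exists P : 'M[R]_d,
    orthogonal_mx P /\ T = P *m plane_rotation d (2 * pi / n%:R) *m P^T.

(* Vertices are numbered 1, ..., n, so vertex i + 1 is represented by
   i : 'I_n. *)
Definition one_twist n d (T : 'M[R]_d) : {ffun 'I_n -> 'M[R]_d} :=
  [ffun i : 'I_n => T ^+ i.+1].

(* Linearization, in the coordinates X_i = Y_i exp(Q_i), of the system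
     X_i' X_i^-1 = 1/2 \sum_j w_ij (X_j X_i^-1 - X_i X_j^-1)
   at a fixed point Y. *)
Definition linearization n d (w : 'M[R]_n) (Y Q : {ffun 'I_n -> 'M[R]_d}) :
    {ffun 'I_n -> 'M[R]_d} :=
  [ffun i => 2^-1 *: \sum_(j < n) w i j *:
     (invmx (Y i) *m Y j *m (Q j - Q i) + (Q j - Q i) *m invmx (Y j) *m Y i)].

(* The linearization acts on so(d)^n, hence the condition on [Q]. *)
Definition linearization_eigenvalue n d (w : 'M[R]_n)
    (Y : {ffun 'I_n -> 'M[R]_d}) (a : R) : Prop :=
  exists Q : {ffun 'I_n -> 'M[R]_d},
    [/\ forall i, skew_symmetric (Q i), Q != 0 & linearization w Y Q = a *: Q].

Definition linearly_unstable n d (w : 'M[R]_n)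
    (Y : {ffun 'I_n -> 'M[R]_d}) : Prop :=
  exists a : R, linearization_eigenvalue w Y a /\ 0 < a.

Definition linearly_stable n d (w : 'M[R]_n)
    (Y : {ffun 'I_n -> 'M[R]_d}) : Prop :=
  forall a : R, linearization_eigenvalue w Y a -> ~ (0 < a).

Definition supports_one_twists (d n : nat) (w : 'M[R]_n) : Prop :=
  forall T : 'M[R]_d, twist_generator n T -> linearly_stable w (one_twist n T).

End Twists.

Section PiecewiseLinear.
Context {R : realType}.

Definition polyhedron m (P : 'cV[R]_m -> Prop) : Prop :=
  exists (p : nat) (A : 'M[R]_(p, m)) (b : 'cV[R]_p),
    forall x, P x <-> forall i, (A *m x) i 0 <= b i 0.

(* Affine on each of finitely many closed polyhedra covering the whole space;
   continuity follows from the pieces being closed. *)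
Definition piecewise_linear m (G : 'cV[R]_m -> R) : Prop :=
  exists (N : nat) (P : 'I_N -> 'cV[R]_m -> Prop)
         (a : 'I_N -> 'rV[R]_m) (c : 'I_N -> R),
    [/\ forall s, polyhedron (P s),
        forall x, exists s, P s x
      & forall s x, P s x -> G x = (a s *m x) 0 0 + c s].

End PiecewiseLinear.

(* Main.v *)
Require Import Defs.
From mathcomp Require Import all_boot all_order all_algebra.
From mathcomp Require Import reals trigo.
From mathcomp Require Import complex zify ring lra.

Set Implicit Arguments.
Unset Strict Implicit.
Unset Printing Implicit Defensive.

Import Order.TTheory GRing.Theory Num.Theory.
Local Open Scope ring_scope.

(** Write [theta = 2 pi / n].  In the orthonormal basis adapted to the twist,
    [Y_i^-1 Y_j] is the rotation by [(j - i) theta] of the plane of the first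
    two vectors, so the linearization at vertex [i] is half the sum over [j] of
    [W (j - i)] times [rot (A_j - A_i) + (A_j - A_i) rot^T], where [W s] is the
    weight at offset [s] and the [A_i] are skew-symmetric.  The entries of such
    an expression decouple into three kinds of scalar problems on the cycle, each
    of the form [b_i |-> \sum_j h (j - i) (b_j - b_i)] with [h] a function on
    Z/n:
    - the entry inside the plane, with [h s = W s * cos (s theta)];
    - the entries outside the plane, with [h = W] (the graph Laplacian);
    - the mixed entries, joined into the complex number [A_0c - i A_1c], with
      [h s = W s * (1 + exp (- i s theta)) / 2].
    Operators of this form are diagonalized by the characters of Z/n, so a real
    eigenvalue is the real part of [\sum_s h (- s) (exp (i m s theta) - 1)] for
    some mode [m].  The first two kinds contribute only nonpositive values as
    soon as the cosines that carry weight are nonnegative, which is what a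
    bandwidth below [n / 4] ensures.  The mixed kind yields half of
      [\sum_s W s * F_m(s)],
      [F_m(s) = cos ((m+1) s theta) + cos (m s theta) - cos (s theta) - 1],
    and everything reduces to the sign of this sum
    ([twist_stable_of_modes] and [twist_unstable_of_mode]).

    The sign is read off the factorization ([twist_mode_prod])
      [F_m(s) = - 4 cos (s theta/2) sin ((m+1) s theta/2) sin (m s theta/2)].
    For [s = 1] and [0 <= m < n] both sines are nonnegative, hence stability
    for nearest neighbor coupling; a divisor [K] of [n] reduces to this case on
    the cycle of length [n / K].  If [K] does not divide [n], let
    [g = gcd (K, n) < K] and choose [m] with [m K = - g] modulo [n]: the angles
    become [g theta] and [(K - g) theta], two positive angles of sum less than
    [pi], and the product is then positive ([exists_twist_mode_gt0]).  Finally,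
    [F_m(1)] is bounded away from [0] except in the modes [m = 0] and
    [m = n - 1], where [F_m] vanishes at every [s].  A large
    [gamma_1] thus dominates the contribution of the longer edges in every
    other mode, and the threshold [G] can even be taken linear
    ([strong_local_coupling_stable]). *)

(** * Trigonometry of the twist modes *)

Section TwistModes.
Context {R : realType}.
Implicit Types (x y t : R) (a b m k n : nat).

(** With half angles [p] and [q], both sides equal
    [2 (cos p ^ 2 + cos q ^ 2 - cos (p + q) ^ 2 - 1)]. *)
Lemma cos_add_sub_cosD x y :
  cos x + cos y - cos (x + y) - 1 =
  4 * cos ((x + y) / 2) * sin (x / 2) * sin (y / 2).
Proof.
pose p := x / 2; pose q := y / 2.
have -> : x = p *+ 2 by rewrite /p; lra.
have -> : y = q *+ 2 by rewrite /q; lra.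
have -> : p *+ 2 + q *+ 2 = (p + q) *+ 2 by rewrite mulrnDl.
have h z : z *+ 2 / 2 = z :> R by lra.
rewrite !h !cos_mulr2n cosD.
have := sin2cos2 p; have := sin2cos2 q.
move: (cos p) (sin p) (cos q) (sin q) => cp sp cq sq hq hp.
suff : (cp * cq) ^+ 2 - (sp * sq) ^+ 2 = cp ^+ 2 + cq ^+ 2 - 1 by nra.
by rewrite !exprMn hp hq; ring.
Qed.

Lemma sin_ge x t : 0 <= t -> t <= x -> x <= pi - t -> sin t <= sin x.
Proof.
move=> t0 tx xt; pose p := (x + t) / 2; pose q := (x - t) / 2.
have -> : x = p + q by rewrite /p /q; lra.
have -> : t = p - q by rewrite /p /q; lra.
have pi0 := @pi_gt0 R.
have cp : 0 <= cos p.
  by apply: cos_ge0_pihalf; apply/andP; split; rewrite /p; lra.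
have sq : 0 <= sin q.
  by apply: sin_ge0_pi; apply/andP; split; rewrite /q; lra.
rewrite sinB sinD; have := mulr_ge0 cp sq; lra.
Qed.

Definition step_angle n : R := 2 * pi / n%:R.

Lemma step_angle_mul n : (0 < n)%N -> n%:R * step_angle n = pi *+ 2.
Proof.
move=> n0; rewrite /step_angle mulrC divfK ?mulr_natl //.
by rewrite pnatr_eq0 -lt0n.
Qed.

Lemma step_angle_gt0 n : (0 < n)%N -> 0 < step_angle n.
Proof. by move=> n0; rewrite divr_gt0 ?mulr_gt0 ?pi_gt0 ?ltr0n. Qed.

Lemma step_angle_dvd n K : (0 < n)%N -> (K %| n)%N ->
  K%:R * step_angle n = step_angle (n %/ K).
Proof.
move=> n0 /dvdnP[q E]; have : (0 < q * K)%N by rewrite -E.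
rewrite muln_gt0 => /andP[q0 K0].
rewrite E mulnK // /step_angle natrM; field.
by rewrite !pnatr_eq0 -!lt0n q0 K0.
Qed.

Lemma cos_step_mod n a b : (0 < n)%N -> a = b %[mod n] ->
  cos (a%:R * step_angle n) = cos (b%:R * step_angle n).
Proof.
move=> n0; suff h c : cos (c%:R * step_angle n) =
  cos ((c %% n)%:R * step_angle n) by move=> E; rewrite h E -h.
rewrite {1}(divn_eq c n) natrD natrM mulrDl -mulrA step_angle_mul //.
rewrite addrC [_%:R * (pi *+ 2)]mulr_natl.
by rewrite (periodicn (@cosD2pi R)).
Qed.

Lemma cos_sin_step_opp n a b : (0 < n)%N -> (n %| a + b)%N ->
  (cos (a%:R * step_angle n) = cos (b%:R * step_angle n)) *
  (sin (a%:R * step_angle n) = - sin (b%:R * step_angle n)).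
Proof.
move=> n0 /dvdnP[q E].
have -> : a%:R * step_angle n = - (b%:R * step_angle n) + (pi *+ 2) *+ q.
  have : (a + b)%:R * step_angle n = (pi *+ 2) *+ q.
    by rewrite E natrM -mulrA step_angle_mul // mulr_natl.
  by move=> <-; rewrite natrD; ring.
by rewrite (periodicn (@cosD2pi R)) (periodicn (@sinD2pi R)) cosN sinN.
Qed.

Lemma cos_step_lt1 n k : (0 < k < n)%N -> cos (k%:R * step_angle n) < 1.
Proof.
move=> /andP[k0 kn]; have n0 := leq_trans k0 (ltnW kn).
have s0 := step_angle_gt0 n0; have E := step_angle_mul n0.
have k0' : (0 : R) < k%:R by rewrite ltr0n.
have kn' : (k%:R : R) < n%:R by rewrite ltr_nat.
have := sin_gt0_pi (x := k%:R * step_angle n / 2); set z := k%:R * _.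
have -> : z = z / 2 *+ 2 by lra.
have h u : u *+ 2 / 2 = u :> R by lra.
rewrite h cos_mulr2n cos2sin2 => /(_ _).
set u := z / 2 => H; have {}H : 0 < sin u.
  apply: H; rewrite /u /z; apply/andP; split; first by rewrite divr_gt0 // mulr_gt0.
  have : k%:R * step_angle n < n%:R * step_angle n by rewrite ltr_pM2r.
  rewrite E; lra.
by have := mulr_gt0 H H; rewrite expr2; lra.
Qed.

Lemma cos_step_ge0 n k : (4 * k <= n)%N -> (0 < n)%N ->
  0 <= cos (k%:R * step_angle n).
Proof.
move=> kn n0; have s0 := step_angle_gt0 n0; have E := step_angle_mul n0.
have pi0 := @pi_gt0 R.
have kn' : 4 * k%:R <= (n%:R : R) by rewrite -natrM ler_nat.
have : 4 * k%:R * step_angle n <= n%:R * step_angle n by rewrite ler_pM2r.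
have : 0 <= k%:R * step_angle n by rewrite mulr_ge0 // ltW.
rewrite E -mulrA; set z := k%:R * _ => z0 z1.
by apply: cos_ge0_pihalf; apply/andP; split; lra.
Qed.

(** Twice the contribution of a unit weight at offset [k] to the eigenvalue of
    the mixed entries in the Fourier mode [m]. *)
Definition twist_mode t m k : R :=
  cos ((m.+1 * k)%:R * t) + cos ((m * k)%:R * t) - cos (k%:R * t) - 1.

(** The sum-to-product identity at the angles [(m+1) k t] and [- m k t], whose
    sum is [k t]. *)
Lemma twist_mode_prod t m k :
  twist_mode t m k = - (4 * cos (k%:R * t / 2) *
    sin ((m.+1 * k)%:R * t / 2) * sin ((m * k)%:R * t / 2)).
Proof.
have := cos_add_sub_cosD ((m.+1 * k)%:R * t) (- ((m * k)%:R * t)).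
rewrite cosN mulNr sinN mulrN.
have -> : (m.+1 * k)%:R * t + - ((m * k)%:R * t) = k%:R * t.
  by rewrite mulSn natrD; ring.
by move=> <-.
Qed.

Lemma twist_mode_mod n m m' k : (0 < n)%N -> m = m' %[mod n] ->
  twist_mode (step_angle n) m k = twist_mode (step_angle n) m' k.
Proof.
move=> n0 E; rewrite /twist_mode; congr (_ + _ - _ - _); apply: cos_step_mod => //.
  by rewrite -modnMml -addn1 -modnDml E modnDml addn1 modnMml.
by rewrite -modnMml E modnMml.
Qed.

(** After reduction of [m] modulo [n], the half angles [m pi / n] and
    [(m+1) pi / n] lie in [[0, pi]], so both sines of the factorization are
    nonnegative. *)
Lemma twist_mode1_le0 n m : (1 < n)%N -> twist_mode (step_angle n) m 1 <= 0.
Proof.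
move=> n1; have n0 := ltnW n1.
rewrite (@twist_mode_mod n m (m %% n)) ?modn_mod //.
have := ltn_pmod m n0; move: (m %% n)%N => {}m mn.
have s0 := step_angle_gt0 n0; have E := step_angle_mul n0.
have pi0 := @pi_gt0 R.
have half j : (j <= n)%N -> 0 <= sin (j%:R * step_angle n / 2).
  move=> jn; apply: sin_ge0_pi; apply/andP; split.
    by rewrite divr_ge0 // mulr_ge0 // ltW.
  have : j%:R * step_angle n <= n%:R * step_angle n by rewrite ler_pM2r // ler_nat.
  rewrite E; lra.
rewrite twist_mode_prod oppr_le0 !muln1 mul1r.
rewrite !mulr_ge0 ?half //; last exact: ltnW.
apply: cos_ge0_pihalf; apply/andP; split; first lra.
have : 2 * step_angle n <= n%:R * step_angle n by rewrite ler_pM2r // ler_nat.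
rewrite E; lra.
Qed.

(** These two modes are neutral for every weight: they are tangent to the two
    symmetries of the system, the right and the left translations of all [X_i]. *)
Lemma twist_mode_edge n m k : (0 < n)%N -> m = 0%N \/ m = n.-1 ->
  twist_mode (step_angle n) m k = 0.
Proof.
move=> n0 [->|->]; rewrite /twist_mode.
  by rewrite mul1n mul0n mul0r cos0; ring.
rewrite prednK // (@cos_step_mod n (n * k) 0) ?modnMr ?mod0n //.
rewrite (@cos_sin_step_opp n (n.-1 * k) k) // ?mul0r ?cos0; first by ring.
by rewrite -mulSnr prednK // dvdn_mulr.
Qed.

(** The value of [- twist_mode] at offset 1 with both sines replaced by their
    smallest value over the modes that are not neutral. *)
Definition mode_gap n : R := 4 * cos (pi / n%:R) * sin (pi / n%:R) ^+ 2.

Lemma mode_gap_gt0 n : (2 < n)%N -> 0 < mode_gap n.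
Proof.
move=> n2; have pi0 := @pi_gt0 R.
have n0 : (0 : R) < n%:R by rewrite ltr0n; lia.
have n2' : (3 : R) <= n%:R by rewrite ler_nat.
have p0 : 0 < pi / n%:R :> R by rewrite divr_gt0.
have p1 : 3 * (pi / n%:R) <= pi :> R.
  by rewrite mulrCA ger_pMr // ler_pdivrMr // mul1r.
have c0 : 0 < cos (pi / n%:R) :> R.
  by apply: cos_gt0_pihalf; apply/andP; split; lra.
have s0 : 0 < sin (pi / n%:R) :> R.
  by apply: sin_gt0_pi; apply/andP; split; lra.
by rewrite !mulr_gt0 // exprn_gt0.
Qed.

Lemma twist_mode1_gap n m : (2 < n)%N -> (0 < m)%N -> (m.+1 < n)%N ->
  twist_mode (step_angle n) m 1 <= - mode_gap n.
Proof.
move=> n2 m0 mn; have pi0 := @pi_gt0 R.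
have n0 : (0 : R) < n%:R by rewrite ltr0n; lia.
have p0 : 0 < pi / n%:R :> R by rewrite divr_gt0.
have E : n%:R * (pi / n%:R) = pi :> R by rewrite mulrC divfK ?gt_eqF.
have half j : j%:R * step_angle n / 2 = j%:R * (pi / n%:R).
  by rewrite /step_angle; field; rewrite gt_eqF.
have sge j : (0 < j < n)%N -> sin (pi / n%:R) <= sin (j%:R * step_angle n / 2) :> R.
  move=> /andP[j0 jn]; rewrite half; apply: sin_ge; first exact: ltW.
    by rewrite ler_peMl ?ler1n // ltW.
  rewrite -[X in _ <= X - _]E -[X in _ - X]mul1r -mulrBl ler_pM2r //.
  by rewrite lerBrDr natr1 ler_nat.
rewrite twist_mode_prod lerN2 /mode_gap !muln1 (half 1%N) mul1r expr2.
have n3 : (3 : R) <= n%:R by rewrite ler_nat.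
have p1 : 3 * (pi / n%:R) <= pi :> R by rewrite -[X in _ <= X]E ler_pM2r.
have c0 : 0 <= cos (pi / n%:R) :> R.
  by apply: cos_ge0_pihalf; apply/andP; split; lra.
have s0 : 0 <= sin (pi / n%:R) :> R.
  by apply: sin_ge0_pi; apply/andP; split; lra.
rewrite -[leRHS]mulrA ler_wpM2l ?mulr_ge0 //.
by rewrite ler_pM // sge ?m0 ?mn // ltnW.
Qed.

Lemma twist_mode_le4 t m k : twist_mode t m k <= 4.
Proof.
rewrite /twist_mode.
have := cos_le1 ((m.+1 * k)%:R * t); have := cos_le1 ((m * k)%:R * t).
have := cos_geN1 (k%:R * t); lra.
Qed.

(** The offsets that are multiples of a divisor [K] form a nearest neighbor
    problem on the cycle of length [n %/ K]. *)
Lemma twist_mode_dvd n K m : (0 < K)%N -> (4 * K < n)%N -> (K %| n)%N ->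
  twist_mode (step_angle n) m K <= 0.
Proof.
move=> K0 Kn Kdn; have n0 : (0 < n)%N by lia.
have -> : twist_mode (step_angle n) m K = twist_mode (step_angle (n %/ K)) m 1.
  by rewrite /twist_mode !muln1 !natrM -!mulrA step_angle_dvd // mul1r.
by apply: twist_mode1_le0; rewrite ltn_divRL // mul1n; lia.
Qed.

(** The mode is chosen so that [m K] is [- gcd (K, n)] modulo [n]; then the
    mode sum is [cos x + cos y - cos (x + y) - 1] with [x, y > 0] and
    [x + y = K theta < pi]. *)
Lemma exists_twist_mode_gt0 n K : (1 <= K <= n./2)%N -> ~ (K %| n)%N ->
  exists m, 0 < twist_mode (step_angle n) m K.
Proof.
move=> /andP[K0 Kn2] nKn; have n0 : (0 < n)%N by lia.
case: (egcdnP n K0) => u v E _.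
pose g := gcdn K n.
have gK : (g < K)%N.
  rewrite ltn_neqAle dvdn_leq ?dvdn_gcdl // andbT.
  by apply/eqP => h; apply: nKn; rewrite -h dvdn_gcdr.
have g0 : (0 < g)%N by rewrite gcdn_gt0 K0.
have Kn : (K.*2 < n)%N.
  have := odd_double_half n; case: (odd n) => /= h; first lia.
  rewrite ltn_neqAle; apply/andP; split; last lia.
  by apply/eqP => h'; apply: nKn; rewrite -h' -muln2 dvdn_mulr.
(* [u] inverts [K] up to the gcd, and [n.-1] stands for [-1] modulo [n]. *)
exists (u * n.-1)%N; rewrite /twist_mode.
have Em : (u * n.-1 * K + g)%N = (n * (u * K - v))%N.
  rewrite mulnAC E -/g; have : (0 < u)%N.
    by rewrite lt0n; apply/eqP=> u0; move: E; rewrite u0; lia.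
  move: g0 E; rewrite -/g; case: (n) n0 => // n' _ _ E u0 /=; nia.
have d1 : (n %| u * n.-1 * K + g)%N by rewrite Em dvdn_mulr.
rewrite (cos_sin_step_opp n0 d1).1.
rewrite (@cos_step_mod n _ (K - g)%N) //; last first.
  apply/eqP; rewrite -(eqn_modDr g) subnK ?(ltnW gK) //.
  by rewrite mulSn -addnA -modnDmr (eqP d1) addn0.
have -> : K%:R * step_angle n = (K - g)%:R * step_angle n + g%:R * step_angle n.
  by rewrite -mulrDl -natrD subnK // ltnW.
rewrite cos_add_sub_cosD.
have s0 := step_angle_gt0 n0; have Es := step_angle_mul n0.
have x0 : 0 < (K - g)%:R * step_angle n by rewrite mulr_gt0 ?ltr0n ?subn_gt0.
have y0 : 0 < g%:R * step_angle n by rewrite mulr_gt0 ?ltr0n.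
have xy : (K - g)%:R * step_angle n + g%:R * step_angle n < pi.
  rewrite -mulrDl -natrD subnK ?(ltnW gK) //.
  have : K.*2%:R * step_angle n < n%:R * step_angle n by rewrite ltr_pM2r // ltr_nat.
  by rewrite -mul2n natrM Es -mulrA; lra.
move: x0 y0 xy; move: (_%:R * _) (_%:R * _) => x y x0 y0 xy.
rewrite !mulr_gt0 //.
- by apply: cos_gt0_pihalf; apply/andP; split; lra.
- by apply: sin_gt0_pi; apply/andP; split; lra.
- by apply: sin_gt0_pi; apply/andP; split; lra.
Qed.

End TwistModes.

(** * Circulant operators and characters of the cycle *)

Section CirculantOperator.
Variables (F : fieldType) (n : nat).
Implicit Types (h b chi : 'I_n.+1 -> F).

Definition circ_op h b (i : 'I_n.+1) : F := \sum_j h (j - i) * (b j - b i).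

(** Characters are eigenvectors, because
    [chi j - chi i = chi i * (chi (j - i) - 1)]. *)
Lemma circ_op_char h chi i : {morph chi : x y / x + y >-> x * y} ->
  circ_op h chi i = (\sum_s h s * (chi s - 1)) * chi i.
Proof.
move=> chiD; rewrite /circ_op (reindex_inj (addIr i)) /= mulr_suml.
by apply: eq_bigr => s _; rewrite addrK chiD; ring.
Qed.

(** Characters are also left eigenvectors.  Pairing an eigenvector with a
    character that does not annihilate it computes the eigenvalue, without
    decomposing the eigenvector. *)
Lemma sum_char_circ_op h b chi : {morph chi : x y / x + y >-> x * y} ->
  \sum_i chi i * circ_op h b i =
  (\sum_s h s * (chi (- s) - 1)) * \sum_i chi i * b i.
Proof.
move=> chiD; rewrite /circ_op.
have -> : \sum_i chi i * (\sum_j h (j - i) * (b j - b i)) =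
    \sum_i (\sum_j h (j - i) * (chi i * b j)) -
    \sum_i (\sum_j h (j - i) * (chi i * b i)).
  rewrite -sumrB; apply: eq_bigr => i _; rewrite mulr_sumr -sumrB.
  by apply: eq_bigr => j _; ring.
rewrite exchange_big /= -sumrB mulr_sumr; apply: eq_bigr => j _.
rewrite (reindex_inj (can_inj (subKr j))) /=.
rewrite [X in _ - X](reindex_inj (addIr j)) /= -sumrB mulr_suml.
by apply: eq_bigr => s _; rewrite subKr addrK [j - s]addrC chiD; ring.
Qed.

End CirculantOperator.

Section Fourier.
Context {R : realType}.
Implicit Types (n : nat).

Definition step_root n : R[i] := Complex (cos (step_angle n)) (sin (step_angle n)).

Lemma step_root_exp n k : step_root n ^+ k =
  Complex (cos (k%:R * step_angle n)) (sin (k%:R * step_angle n)).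
Proof.
elim: k => [|k IH]; first by rewrite expr0 mul0r cos0 sin0.
rewrite exprS IH -natr1 mulrDl mul1r addrC cosD sinD.
by apply/eqP; rewrite eq_complex /= !eqxx /= addrC.
Qed.

Lemma step_root_prim n : (0 < n)%N -> n.-primitive_root (step_root n).
Proof.
move=> n0; apply/andP; split=> //; apply/forallP => i; apply/eqP.
rewrite unity_rootE step_root_exp eq_complex /=.
have [->|ni] := eqVneq i.+1 n.
  by rewrite step_angle_mul // cos2pi sin2pi !eqxx.
rewrite lt_eqF // cos_step_lt1 //=.
by rewrite ltn_neqAle ni /= ltn_ord.
Qed.

Variable n : nat.
Implicit Types (h b : 'I_n.+1 -> R[i]) (m s : 'I_n.+1).

Definition twist_char (m : nat) (s : 'I_n.+1) : R[i] := step_root n.+1 ^+ (s * m).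

Lemma twist_charD (m : nat) : {morph twist_char m : x y / x + y >-> x * y}.
Proof.
move=> x y; rewrite /twist_char -exprD -mulnDl !exprM /=.
rewrite (expr_mod _ (prim_expr_order _)) //.
exact: step_root_prim.
Qed.

Lemma ord_opp_dvd (s : 'I_n.+1) : (n.+1 %| (- s)%R + s)%N.
Proof. by apply/eqP; exact: (congr1 val (addNr s)). Qed.

Lemma twist_charN (m : nat) s : twist_char m (- s) = conjc (twist_char m s).
Proof.
have d : (n.+1 %| (- s)%R * m + s * m)%N by rewrite -mulnDl dvdn_mulr ?ord_opp_dvd.
by rewrite /twist_char !step_root_exp !(cos_sin_step_opp _ d).
Qed.

(** The transform of [b] lists the values of the polynomial with coefficients
    [b], of degree at most [n], at the [n + 1] distinct roots of unity. *)
Lemma fourier_inj b : (forall m, \sum_i twist_char m i * b i = 0) ->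
  forall i, b i = 0.
Proof.
move=> h0; pose p := \poly_(k < n.+1) b (inord k).
have prim := step_root_prim (ltn0Sn n).
have pE x : p.[x] = \sum_(i < n.+1) b i * x ^+ i.
  rewrite horner_poly; apply: eq_bigr => i _; by rewrite inord_val.
have p0 : p = 0.
  apply/eqP/negPn/negP => pn0.
  pose zs := [seq step_root n.+1 ^+ val m | m : 'I_n.+1].
  have zs_root : all (root p) zs.
    apply/allP => _ /mapP[m _ ->]; apply/rootP; rewrite pE -[RHS](h0 m).
    by apply: eq_bigr => i _; rewrite /twist_char -exprM mulnC mulrC.
  have zs_uniq : uniq zs.
    rewrite map_inj_uniq ?enum_uniq // => x y /eqP.
    by rewrite (eq_prim_root_expr prim) !modn_small ?ltn_ord // => /eqP/val_inj.
  have := max_poly_roots pn0 zs_root zs_uniq.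
  by rewrite size_map size_enum_ord ltnNge size_poly.
move=> i; have := coef_poly n.+1 (fun k => b (inord k)) i.
by rewrite -/p p0 coef0 ltn_ord inord_val.
Qed.

Lemma Re_sum (I : finType) (f : I -> R[i]) :
  complex.Re (\sum_i f i) = \sum_i complex.Re (f i).
Proof. by apply: (big_morph (@complex.Re R)) => // -[a b] [c d]. Qed.

Lemma Im_sum (I : finType) (f : I -> R[i]) :
  complex.Im (\sum_i f i) = \sum_i complex.Im (f i).
Proof. by apply: (big_morph (@complex.Im R)) => // -[a b] [c d]. Qed.

(** Some character pairs nontrivially with a nonzero eigenvector, and then the
    eigenvalue is the real part of the symbol at that character. *)
Lemma circ_op_eigen_le0 h b (a : R) :
  (forall m : nat, \sum_s complex.Re (h (- s) * (twist_char m s - 1)) <= 0) ->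
  (forall i, circ_op h b i = (a%:C)%C * b i) -> 0 < a -> forall i, b i = 0.
Proof.
move=> neg eig a0; apply: fourier_inj => m; apply/eqP/negPn/negP => Sn0.
have := sum_char_circ_op h b (twist_charD m).
under eq_bigr do rewrite eig mulrCA.
rewrite -mulr_sumr => /(mulIf Sn0) /(congr1 (@complex.Re R)).
rewrite Re_sum (reindex_inj oppr_inj) /= => E.
have := neg m; have -> : \sum_s complex.Re (h (- s) * (twist_char m s - 1)) = a.
  by rewrite E; apply: eq_bigr => s _; rewrite opprK.
by rewrite leNgt a0.
Qed.

End Fourier.

(** * Plane rotations and skew-symmetric matrices *)

Section PlaneRotation.
Context {R : realType}.
Variable e : nat.
Local Notation d := e.+2.
Local Notation i0 := (ord0 : 'I_d).
Local Notation i1 := (lift ord0 ord0 : 'I_d).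
Local Notation rot := (@plane_rotation R d).
Implicit Types (t u : R).

Lemma plane_row_case (Pr : 'I_d -> Prop) :
  Pr i0 -> Pr i1 -> (forall r : 'I_d, (1 < r)%N -> Pr r) -> forall r, Pr r.
Proof.
move=> P0 P1 P2 r; case: (unliftP i0 r) => [r'|] -> //.
by case: (unliftP ord0 r') => [r''|] -> //; apply: P2.
Qed.

Lemma plane_rotation_mul0 p t (A : 'M[R]_(d, p)) c :
  (rot t *m A) i0 c = cos t * A i0 c - sin t * A i1 c.
Proof.
rewrite mxE !big_ord_recl big1 ?addr0; first by rewrite !mxE /= mulNr.
by move=> k _; rewrite !mxE /= mul0r.
Qed.

Lemma plane_rotation_mul1 p t (A : 'M[R]_(d, p)) c :
  (rot t *m A) i1 c = sin t * A i0 c + cos t * A i1 c.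
Proof.
rewrite mxE !big_ord_recl big1 ?addr0; first by rewrite !mxE /=.
by move=> k _; rewrite !mxE /= mul0r.
Qed.

Lemma plane_rotation_mul2 p t (A : 'M[R]_(d, p)) (r : 'I_d) c : (1 < r)%N ->
  (rot t *m A) r c = A r c.
Proof.
move=> r1; rewrite mxE (bigD1 r) //= big1 ?addr0.
  by rewrite mxE; case: r r1 => [[|[|r]] rd] //= _; rewrite eqxx mul1r.
move=> k kr; rewrite mxE; case: r r1 kr => [[|[|r]] rd] //= _.
by rewrite eq_sym => /negbTE->; rewrite mul0r.
Qed.

Lemma plane_rotationD t u : rot (t + u) = rot t *m rot u.
Proof.
apply/matrixP => r c; elim/plane_row_case: r => [||r r1].
- rewrite plane_rotation_mul0 !mxE /=.
  by case: c => [[|[|c]] cd] //=; rewrite ?cosD ?sinD; ring.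
- rewrite plane_rotation_mul1 !mxE /=.
  by case: c => [[|[|c]] cd] //=; rewrite ?cosD ?sinD; ring.
- by rewrite plane_rotation_mul2 // !mxE; case: r r1 => [[|[|r]] rd].
Qed.

Lemma plane_rotation_tr t : (rot t)^T = rot (- t).
Proof.
apply/matrixP => r c; rewrite !mxE cosN sinN opprK eq_sym.
by case: r c => [[|[|r]] rd] [[|[|c]] cd].
Qed.

Lemma plane_rotation_period t : cos t = 1 -> sin t = 0 -> rot t = 1%:M.
Proof.
move=> ct st; apply/matrixP => r c; rewrite !mxE ct st oppr0.
by case: r c => [[|[|r]] rd] [[|[|c]] cd].
Qed.

(** The determinant is 1 because a rotation is the square of the rotation by
    half the angle, which is orthogonal. *)
Lemma plane_rotation_special t : special_orthogonal (rot t).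
Proof.
have orth u : orthogonal_mx (rot u).
  rewrite /orthogonal_mx plane_rotation_tr -plane_rotationD addNr.
  by rewrite plane_rotation_period ?cos0 ?sin0.
split=> //; have -> : t = t / 2 + t / 2 by lra.
rewrite plane_rotationD det_mulmx -{1}det_tr -det_mulmx orth.
exact: det1.
Qed.

Definition rotation_term t (B : 'M[R]_d) := rot t *m B + B *m (rot t)^T.

(** For skew-symmetric matrices the two terms are opposite transposes, so only
    the left product has to be computed. *)
Lemma rotation_termE t B : skew_symmetric B ->
  rotation_term t B = rot t *m B - (rot t *m B)^T.
Proof. by move=> skB; rewrite /rotation_term trmx_mul skB mulNmx opprK. Qed.

Lemma skew_entry (B : 'M[R]_d) : skew_symmetric B -> forall r c, B r c = - B c r.
Proof. by move=> skB r c; have /matrixP/(_ c r) := skB; rewrite !mxE. Qed.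

Lemma skew_diag (B : 'M[R]_d) : skew_symmetric B -> forall r, B r r = 0.
Proof. by move=> skB r; have := skew_entry skB r r; lra. Qed.

Lemma rotation_term_plane t B : skew_symmetric B ->
  rotation_term t B i0 i1 = 2 * cos t * B i0 i1.
Proof.
move=> skB; rewrite rotation_termE // mxE [X in _ + X]mxE [X in _ - X]mxE.
rewrite plane_rotation_mul0 plane_rotation_mul1.
by rewrite (skew_entry skB i1 i0) !(skew_diag skB); ring.
Qed.

Lemma rotation_term_off0 t (B : 'M[R]_d) (c : 'I_d) : skew_symmetric B -> (1 < c)%N ->
  rotation_term t B i0 c = (cos t + 1) * B i0 c - sin t * B i1 c.
Proof.
move=> skB c1; rewrite rotation_termE // mxE [X in _ + X]mxE [X in _ - X]mxE.
rewrite plane_rotation_mul0 plane_rotation_mul2 //.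
by rewrite (skew_entry skB c i0); ring.
Qed.

Lemma rotation_term_off1 t (B : 'M[R]_d) (c : 'I_d) : skew_symmetric B -> (1 < c)%N ->
  rotation_term t B i1 c = sin t * B i0 c + (cos t + 1) * B i1 c.
Proof.
move=> skB c1; rewrite rotation_termE // mxE [X in _ + X]mxE [X in _ - X]mxE.
rewrite plane_rotation_mul1 plane_rotation_mul2 //.
by rewrite (skew_entry skB c i1); ring.
Qed.

Lemma rotation_term_rest t (B : 'M[R]_d) (r c : 'I_d) :
  skew_symmetric B -> (1 < r)%N -> (1 < c)%N ->
  rotation_term t B r c = 2 * B r c.
Proof.
move=> skB r1 c1; rewrite rotation_termE // mxE [X in _ + X]mxE [X in _ - X]mxE.
by rewrite !plane_rotation_mul2 // (skew_entry skB c r); ring.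
Qed.

Lemma rotation_term_skew t B : skew_symmetric B ->
  skew_symmetric (rotation_term t B).
Proof.
move=> skB; rewrite rotation_termE // /skew_symmetric linearB /= trmxK.
by rewrite opprB.
Qed.

Lemma skew_ext (M N : 'M[R]_d) : skew_symmetric M -> skew_symmetric N ->
  M i0 i1 = N i0 i1 -> (forall c : 'I_d, (1 < c)%N -> M i0 c = N i0 c) ->
  (forall c : 'I_d, (1 < c)%N -> M i1 c = N i1 c) ->
  (forall r c : 'I_d, (1 < r)%N -> (1 < c)%N -> M r c = N r c) -> M = N.
Proof.
move=> skM skN e01 e0 e1 e2; apply/matrixP => r c.
elim/plane_row_case: r => [||r r1]; elim/plane_row_case: c => [||c c1].
- by rewrite !skew_diag.
- exact: e01.
- exact: e0.
- by rewrite (skew_entry skM) (skew_entry skN) e01.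
- by rewrite !skew_diag.
- exact: e1.
- by rewrite (skew_entry skM) (skew_entry skN) e0.
- by rewrite (skew_entry skM) (skew_entry skN) e1.
- exact: e2.
Qed.

End PlaneRotation.

(** * The linearization in the rotating frame *)

Section ConjugatedLinearization.
Context {R : realType}.
Variables (n e : nat).
Local Notation N := n.+1.
Local Notation d := e.+2.
Implicit Types (w : 'M[R]_N) (gamma : nat -> R) (s : 'I_N).

(** The weights as a function on Z/N.  Loops do not act on the dynamics,
    and the value 0 there keeps the function nonnegative. *)
Definition offset_weight gamma s : R :=
  if s == 0 then 0 else gamma (minn s (N - s)).

Lemma cyclic_dist_sub (i j : 'I_N) : i != j ->
  cyclic_dist i j = minn (j - i)%R (N - (j - i)%R).
Proof.
move=> ij; have {}ij : (i : nat) <> j by move/val_inj/eqP; rewrite (negbTE ij).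
have := ltn_ord i; have := ltn_ord j; rewrite /cyclic_dist /= => jn iN.
have -> : ((j + (N - i) %% N) %% N)%N = (if i <= j then j - i else j + N - i)%N.
  rewrite modnDmr; case: leqP => h.
    have -> : (j + (N - i) = (j - i) + N)%N by lia.
    by rewrite modnDr modn_small //; lia.
  by rewrite modn_small; lia.
case: leqP => h; lia.
Qed.

(** Subtraction on ['I_N] is modulo [N], and the cyclic distance of [i] and [j]
    is that of [j - i] to 0. *)
Lemma circulant_offset w gamma i j : symmetric_circulant w gamma -> i != j ->
  w i j = offset_weight gamma (j - i).
Proof.
move=> [_ wE] ij; rewrite wE // cyclic_dist_sub // /offset_weight subr_eq0 eq_sym.
by rewrite (negbTE ij).
Qed.

Lemma offset_weight_ge0 w gamma s : symmetric_circulant w gamma ->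
  0 <= offset_weight gamma s.
Proof.
move=> wc; have [->|s0] := eqVneq s 0; first by rewrite /offset_weight eqxx.
by rewrite -[s]subr0 -(circulant_offset wc) 1?eq_sym // wc.1.2.
Qed.

(** The linearization at the twist, read in the basis given by the columns
    of [P]. *)
Definition rotation_laplacian (W : 'I_N -> R) (A : 'I_N -> 'M[R]_d) i : 'M[R]_d :=
  2^-1 *: \sum_j W (j - i) *:
    rotation_term ((j - i)%R%:R * step_angle N) (A j - A i).

Lemma skew_symmetricB (A B : 'M[R]_d) : skew_symmetric A -> skew_symmetric B ->
  skew_symmetric (A - B).
Proof. by move=> skA skB; rewrite /skew_symmetric linearB /= skA skB opprD. Qed.

Lemma rotation_laplacian_skew W A i : (forall j, skew_symmetric (A j)) ->
  skew_symmetric (rotation_laplacian W A i).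
Proof.
move=> skA; rewrite /skew_symmetric linearZ /= -scalerN; congr (_ *: _).
rewrite linear_sum -sumrN; apply: eq_bigr => j _.
rewrite linearZ /= -scalerN; congr (_ *: _).
by apply: rotation_term_skew; apply: skew_symmetricB.
Qed.

Section Twist.
Variables (P T : 'M[R]_d).
Hypotheses (orthP : orthogonal_mx P)
  (TE : T = P *m plane_rotation d (step_angle N) *m P^T).

Lemma twist_expE k : T ^+ k = P *m plane_rotation d (k%:R * step_angle N) *m P^T.
Proof.
elim: k => [|k IH].
  rewrite expr0 mul0r plane_rotation_period ?cos0 ?sin0 // mulmx1.
  by rewrite (mulmx1C orthP).
rewrite exprSr IH TE -natr1 mulrDl mul1r plane_rotationD -!mulmxE !mulmxA.
by rewrite -[X in X *m plane_rotation _ _ *m _]mulmxA orthP mulmx1.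
Qed.

Lemma twist_exp_period : T ^+ N = 1.
Proof.
rewrite twist_expE step_angle_mul // plane_rotation_period ?cos2pi ?sin2pi //.
by rewrite mulmx1 (mulmx1C orthP).
Qed.

Lemma twist_exp_unit k : T ^+ k \in unitmx.
Proof.
have : T ^+ k *m T ^+ (N * k - k) = 1%:M.
  rewrite mulmxE -exprD subnKC; last by rewrite leq_pmull.
  by rewrite exprM twist_exp_period expr1n.
by case/mulmx1_unit.
Qed.

Lemma twist_relative (i j : 'I_N) :
  invmx (T ^+ i.+1) *m T ^+ j.+1 = T ^+ (j - i)%R.
Proof.
suff -> : T ^+ j.+1 = T ^+ i.+1 *m T ^+ (j - i)%R by rewrite mulKmx ?twist_exp_unit.
rewrite mulmxE -exprD addSn !exprS; congr (_ * _).
rewrite -[in RHS](expr_mod _ twist_exp_period).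
congr (T ^+ _); exact: (esym (congr1 val (subrKC i j))).
Qed.

Lemma twist_relativeV (i j : 'I_N) :
  invmx (T ^+ j.+1) *m T ^+ i.+1 = (T ^+ (j - i)%R)^T.
Proof.
set a := T ^+ j.+1; set b := T ^+ i.+1.
have -> : invmx a *m b = invmx (invmx b *m a).
  rewrite -[LHS]mulmx1 -[X in _ *m X](@mulmxV _ _ (invmx b *m a)); last first.
    by rewrite unitmx_mul unitmx_inv !twist_exp_unit.
  by rewrite !mulmxA mulmxK ?twist_exp_unit // mulVmx ?twist_exp_unit // mul1mx.
rewrite twist_relative; set c := T ^+ _.
suff h : c^T *m c = 1%:M by rewrite -[LHS]mul1mx -h mulmxK // twist_exp_unit.
rewrite /c twist_expE !trmx_mul trmxK !mulmxA.
rewrite -[X in X *m plane_rotation _ _ *m _]mulmxA orthP mulmx1.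
rewrite -[X in X *m _]mulmxA (plane_rotation_special _ _).1 mulmx1.
exact: mulmx1C.
Qed.

(** Relative positions [Y_i^-1 Y_j] depend only on the class of [j - i] modulo
    [N], since the twist generator has order dividing [N]. *)
Lemma linearization_conj w gamma (A : 'I_N -> 'M[R]_d) i :
  symmetric_circulant w gamma ->
  linearization w (one_twist N T) [ffun i => P *m A i *m P^T] i =
  P *m rotation_laplacian (offset_weight gamma) A i *m P^T.
Proof.
move=> wc; rewrite ffunE /rotation_laplacian -scalemxAr -scalemxAl; congr (_ *: _).
rewrite mulmx_sumr mulmx_suml; apply: eq_bigr => j _; rewrite !ffunE.
have [<-|ij] := eqVneq i j.
  by rewrite !subrr /offset_weight eqxx scale0r !(mulmx0, mul0mx, addr0) scaler0.
rewrite (circulant_offset wc ij) -scalemxAr -scalemxAl; congr (_ *: _).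
rewrite twist_relative -[X in _ + X]mulmxA twist_relativeV twist_expE.
have -> : P *m A j *m P^T - P *m A i *m P^T = P *m (A j - A i) *m P^T.
  by rewrite mulmxBr mulmxBl.
rewrite /rotation_term !trmx_mul trmxK.
move: (A j - A i) (plane_rotation _ _) => B S.
rewrite mulmxDr mulmxDl !mulmxA; congr (_ + _).
  by rewrite -[X in X *m B *m _]mulmxA orthP mulmx1.
by rewrite -[X in X *m S^T *m _]mulmxA orthP mulmx1.
Qed.

End Twist.
End ConjugatedLinearization.

(** * Spectrum of the linearization at a twist *)

Section Spectrum.
Context {R : realType}.
Variables (n e : nat).
Local Notation N := n.+1.
Local Notation d := e.+2.
Local Notation i0 := (ord0 : 'I_d).
Local Notation i1 := (lift ord0 ord0 : 'I_d).
Local Notation theta := (step_angle N).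
Implicit Types (W : 'I_N -> R) (A : 'I_N -> 'M[R]_d) (w : 'M[R]_N).

Definition plane_kernel W (s : 'I_N) : R[i] := Complex (W s * cos (s%:R * theta)) 0.
Definition rest_kernel W (s : 'I_N) : R[i] := Complex (W s) 0.

(** Equals [W s / 2 * (1 + exp (- i s theta))]: the sign is that of the action
    of a rotation on [A_0c - i A_1c]. *)
Definition mixed_kernel W (s : 'I_N) : R[i] :=
  Complex (W s / 2 * (cos (s%:R * theta) + 1)) (- (W s / 2 * sin (s%:R * theta))).

Section Components.
Variables (W : 'I_N -> R) (A : 'I_N -> 'M[R]_d).
Hypothesis skA : forall i, skew_symmetric (A i).

Lemma rotation_laplacian_plane i :
  Complex (rotation_laplacian W A i i0 i1) 0 =
  circ_op (plane_kernel W) (fun j => Complex (A j i0 i1) 0) i.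
Proof.
apply/eqP; rewrite eq_complex Re_sum Im_sum /=; apply/andP; split; apply/eqP.
  rewrite mxE summxE mulr_sumr; apply: eq_bigr => j _.
  rewrite mxE rotation_term_plane ?mxE; last exact: skew_symmetricB.
  by field.
by rewrite big1 // => j _; ring.
Qed.

Lemma rotation_laplacian_rest i (r c : 'I_d) : (1 < r)%N -> (1 < c)%N ->
  Complex (rotation_laplacian W A i r c) 0 =
  circ_op (rest_kernel W) (fun j => Complex (A j r c) 0) i.
Proof.
move=> r1 c1.
apply/eqP; rewrite eq_complex Re_sum Im_sum /=; apply/andP; split; apply/eqP.
  rewrite mxE summxE mulr_sumr; apply: eq_bigr => j _.
  rewrite mxE rotation_term_rest ?mxE //; last exact: skew_symmetricB.
  by field.
by rewrite big1 // => j _; ring.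
Qed.

Lemma rotation_laplacian_mixed i (c : 'I_d) : (1 < c)%N ->
  Complex (rotation_laplacian W A i i0 c) (- rotation_laplacian W A i i1 c) =
  circ_op (mixed_kernel W) (fun j => Complex (A j i0 c) (- A j i1 c)) i.
Proof.
move=> c1.
apply/eqP; rewrite eq_complex Re_sum Im_sum /=; apply/andP; split; apply/eqP.
  rewrite mxE summxE mulr_sumr; apply: eq_bigr => j _.
  rewrite mxE rotation_term_off0 ?mxE //; last exact: skew_symmetricB.
  by field.
rewrite mxE summxE mulr_sumr -sumrN; apply: eq_bigr => j _.
rewrite mxE rotation_term_off1 ?mxE //; last exact: skew_symmetricB.
by field.
Qed.

End Components.

Lemma offset_weight_opp (gamma : nat -> R) (s : 'I_N) :
  offset_weight gamma (- s) = offset_weight gamma s.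
Proof.
rewrite /offset_weight oppr_eq0; case: eqP => // s0; congr gamma.
have sp : (0 < s)%N by rewrite lt0n; apply/eqP => h; apply: s0; apply: val_inj.
have sN := ltn_ord s.
by rewrite /= modn_small; lia.
Qed.

Lemma mixed_kernelN W (s : 'I_N) : W (- s) = W s ->
  mixed_kernel W (- s) = conjc (mixed_kernel W s).
Proof.
by move=> Ws; rewrite /mixed_kernel !(cos_sin_step_opp _ (ord_opp_dvd s)) // Ws mulrN.
Qed.

(** The real part of
    [(1 + exp (i s theta)) * (exp (i m s theta) - 1)] is the twist mode. *)
Lemma Re_mixed_mode W (m : nat) (s : 'I_N) : W (- s) = W s ->
  complex.Re (mixed_kernel W (- s) * (twist_char m s - 1)) =
  W s / 2 * twist_mode theta m s.
Proof.
move=> Ws; rewrite mixed_kernelN // /twist_char step_root_exp /=.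
rewrite /twist_mode mulnC mulSn natrD mulrDl cosD; ring.
Qed.

Lemma Re_real_mode (x : R) (m : nat) (s : 'I_N) : 0 <= x ->
  complex.Re (Complex x 0 * (twist_char m s - 1)) <= 0.
Proof.
move=> x0; rewrite /twist_char step_root_exp /= mul0r subr0.
by rewrite mulr_ge0_le0 // subr_le0 cos_le1.
Qed.

Lemma complex_ext (z z' : R[i]) : complex.Re z = complex.Re z' ->
  complex.Im z = complex.Im z' -> z = z'.
Proof. by case: z z' => x y [x' y'] /= -> ->. Qed.

Lemma complexZ (a x y : R) : (a%:C)%C * Complex x y = Complex (a * x) (a * y).
Proof. by apply/eqP; rewrite eq_complex /= !mul0r subr0 addr0 !eqxx. Qed.

Definition conj_config (P : 'M[R]_d) A : {ffun 'I_N -> 'M[R]_d} :=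
  [ffun i => P *m A i *m P^T].

Lemma skew_conj (P B : 'M[R]_d) : skew_symmetric B -> skew_symmetric (P *m B *m P^T).
Proof.
by move=> skB; rewrite /skew_symmetric !trmx_mul trmxK skB mulNmx mulmxN mulmxA.
Qed.

(** An eigenvector with positive eigenvalue vanishes in each of the three kinds
    of entries: for the plane entry and the entries outside the plane the symbol
    is a nonnegative combination of the numbers [cos (m s theta) - 1], and for
    the mixed entries it is half of the assumed nonpositive sum. *)
Lemma twist_stable_of_modes w gamma (T : 'M[R]_d) :
  symmetric_circulant w gamma -> twist_generator N T ->
  (forall s : 'I_N, 0 <= offset_weight gamma s * cos (s%:R * theta)) ->
  (forall m : nat, \sum_(s < N) offset_weight gamma s * twist_mode theta m s <= 0) ->
  linearly_stable w (one_twist N T).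
Proof.
move=> wc [_ [P [orthP TE]]] plane_ge0 modes_le0 a [Q [skQ Q0 eigQ]] a0.
set W := @offset_weight R n gamma in plane_ge0 modes_le0.
have W0 s : 0 <= W s by apply: (offset_weight_ge0 s wc).
have WN s : W (- s) = W s by exact: offset_weight_opp.
have orthP' : P *m P^T = 1%:M := mulmx1C orthP.
pose A i : 'M[R]_d := P^T *m Q i *m P.
have QE : Q = conj_config P A.
  apply/ffunP => i; rewrite ffunE /A !mulmxA orthP' mul1mx.
  by rewrite -mulmxA orthP' mulmx1.
have skA i : skew_symmetric (A i).
  by have := @skew_conj P^T _ (skQ i); rewrite trmxK.
have eigA i : rotation_laplacian W A i = a *: A i.
  have /ffunP/(_ i) := eigQ; rewrite [in LHS]QE (linearization_conj orthP TE _ _ wc).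
  rewrite ffunE /A => /(congr1 (fun M => P^T *m M *m P)).
  rewrite !mulmxA orthP mul1mx -mulmxA orthP mulmx1.
  by rewrite -scalemxAr -scalemxAl.
have mixed0 i (c : 'I_d) : (1 < c)%N -> Complex (A i i0 c) (- A i i1 c) = 0.
  move=> c1; move: i.
  apply: (circ_op_eigen_le0 (h := mixed_kernel W) _ _ a0) => [m|j].
    rewrite (eq_bigr (fun s => (W s * twist_mode theta m s) / 2)).
      by rewrite -mulr_suml ler_pdivrMr // mul0r.
    by move=> s _; rewrite (Re_mixed_mode _ (WN s)) mulrAC.
  by rewrite -rotation_laplacian_mixed // eigA !mxE complexZ ?mulr0 ?mulrN.
have A0 i : A i = 0.
  apply: (skew_ext (skA i)) => [||c c1|c c1|r c r1 c1].
  - by rewrite /skew_symmetric trmx0 oppr0.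
  - suff /(_ i) [->] : forall j, Complex (A j i0 i1) 0 = 0 by rewrite mxE.
    apply: (circ_op_eigen_le0 (h := plane_kernel W) _ _ a0) => [m|j].
      by apply: sumr_le0 => s _; exact: Re_real_mode.
    by rewrite -rotation_laplacian_plane // eigA mxE complexZ ?mulr0 ?mulrN.
  - by have [-> _] := mixed0 i c c1; rewrite mxE.
  - by have [_ /eqP] := mixed0 i c c1; rewrite oppr_eq0 => /eqP->; rewrite mxE.
  - suff /(_ i) [->] : forall j, Complex (A j r c) 0 = 0 by rewrite mxE.
    apply: (circ_op_eigen_le0 (h := rest_kernel W) _ _ a0) => [m|j].
      by apply: sumr_le0 => s _; exact: Re_real_mode.
    by rewrite -rotation_laplacian_rest // eigA mxE complexZ ?mulr0 ?mulrN.
case/eqP: Q0; apply/ffunP => i.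
by rewrite QE !ffunE A0 mulmx0 mul0mx.
Qed.

End Spectrum.

Section Instability.
Context {R : realType}.
Variables (n e : nat).
Local Notation N := n.+1.
Local Notation d := e.+3.
Local Notation i0 := (ord0 : 'I_d).
Local Notation i1 := (lift ord0 ord0 : 'I_d).
Local Notation i2 := (lift ord0 (lift ord0 ord0) : 'I_d).
Local Notation theta := (step_angle N).

(** The skew-symmetric matrix supported on the mixed entries of column 2 whose
    complex coordinate [A_0c - i A_1c] is [z]. *)
Definition mixed_direction (z : R[i]) : 'M[R]_d :=
  complex.Re z *: (delta_mx i0 i2 - delta_mx i2 i0) -
  complex.Im z *: (delta_mx i1 i2 - delta_mx i2 i1).

Lemma mixed_direction_skew z : skew_symmetric (mixed_direction z).
Proof.
apply/matrixP => r c; rewrite !mxE ![(c == _) && _]andbC; ring.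
Qed.

Lemma mixed_direction_plane z : mixed_direction z i0 i1 = 0.
Proof. by rewrite !mxE /=; ring. Qed.

Lemma mixed_direction_rest z (r c : 'I_d) : (1 < r)%N -> (1 < c)%N ->
  mixed_direction z r c = 0.
Proof.
rewrite !mxE -!val_eqE /=.
by case: r c => [[|[|r]] rd] [[|[|c]] cd] //= _ _; rewrite !andbF /=; ring.
Qed.

Lemma mixed_direction_mixed z (c : 'I_d) : (1 < c)%N ->
  Complex (mixed_direction z i0 c) (- mixed_direction z i1 c) =
  if c == i2 then z else 0.
Proof.
case: z => x y; rewrite !mxE -!val_eqE /=.
case: c => [[|[|[|c]]] cd] //= _; apply/eqP; rewrite eq_complex /=; apply/andP;
  by split; apply/eqP; ring.
Qed.

(** The eigenvector places a character in the mixed entries of one column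
    outside the plane, which is where dimension 3 is used.  Its eigenvalue is
    real because replacing [s] by [- s] conjugates the symbol. *)
Lemma twist_unstable_of_mode (w : 'M[R]_N) gamma (T : 'M[R]_d) (m : nat) :
  symmetric_circulant w gamma -> twist_generator N T ->
  0 < \sum_(s < N) offset_weight gamma s * twist_mode theta m s ->
  linearly_unstable w (one_twist N T).
Proof.
move=> wc [_ [P [orthP TE]]].
set W := @offset_weight R n gamma; set S := \sum_s _ => S0.
exists (S / 2); split; last by rewrite divr_gt0.
have WN s : W (- s) = W s by exact: offset_weight_opp.
pose b (i : 'I_N) : R[i] := twist_char m (- i).
pose A (i : 'I_N) := mixed_direction (b i).
have skA i : skew_symmetric (A i) by exact: mixed_direction_skew.
exists (conj_config P A); split.
- by move=> i; rewrite ffunE; apply: skew_conj.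
- apply/eqP => /ffunP/(_ 0); rewrite !ffunE => /(congr1 (fun M => P^T *m M *m P)).
  rewrite !mulmxA orthP mul1mx -mulmxA orthP mulmx1 mulmx0 mul0mx.
  move=> /matrixP/(_ i0 i2); rewrite !mxE /= /b oppr0 /twist_char mul0n expr0 /=.
  by move=> /eqP; rewrite !(mulr0, mulr1, subr0) oner_eq0.
apply/ffunP => i; rewrite (linearization_conj orthP TE _ _ wc) [RHS]ffunE ffunE.
rewrite scalemxAl scalemxAr; congr (_ *m _ *m _).
have eigb : circ_op (mixed_kernel W) b i = ((S / 2)%:C)%C * b i.
  rewrite circ_op_char; last first.
    by move=> x y; rewrite /b opprD twist_charD.
  congr (_ * _); rewrite (reindex_inj oppr_inj) /=.
  apply: complex_ext; rewrite ?Re_sum ?Im_sum.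
    rewrite [RHS]/= /S mulr_suml; apply: eq_bigr => s _.
    by rewrite /b opprK (Re_mixed_mode _ (WN s)) mulrAC.
  rewrite [RHS]/=; set X := \sum_s _; suff : X = - X by lra.
  rewrite {1}/X (reindex_inj oppr_inj) -sumrN; apply: eq_bigr => s _.
  rewrite /b !opprK twist_charN (mixed_kernelN (WN s)).
  by case: (mixed_kernel W s) (twist_char m s) => x y [x' y'] /=; ring.
have circ0 h b' : (forall j, b' j = 0) -> @circ_op _ n h b' i = 0.
  by move=> b0; rewrite /circ_op big1 // => j _; rewrite !b0 subrr mulr0.
have mixed (c : 'I_d) : (1 < c)%N ->
    Complex (rotation_laplacian W A i i0 c) (- rotation_laplacian W A i i1 c) =
    ((S / 2)%:C)%C * Complex (A i i0 c) (- A i i1 c).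
  move=> c1; rewrite rotation_laplacian_mixed // mixed_direction_mixed //.
  have [->|ci2] := eqVneq c i2.
    by rewrite -eigb; apply: eq_bigr => j _; rewrite !mixed_direction_mixed.
  rewrite mulr0; apply: circ0 => j.
  by rewrite mixed_direction_mixed // (negbTE ci2).
apply: skew_ext => [|||c c1|c c1|r c r1 c1].
- exact: rotation_laplacian_skew.
- by rewrite /skew_symmetric linearZ /= skA scalerN.
- suff [->] : Complex (rotation_laplacian W A i i0 i1) 0 = 0.
    by rewrite mxE mixed_direction_plane mulr0.
  rewrite rotation_laplacian_plane //; apply: circ0 => j.
  by rewrite mixed_direction_plane.
- by have := mixed c c1; rewrite complexZ => -[-> _]; rewrite [RHS]mxE.
- have := mixed c c1; rewrite complexZ mulrN => -[_ /eqP]; rewrite eqr_opp => /eqP->.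
  by rewrite [RHS]mxE.
- suff [->] : Complex (rotation_laplacian W A i r c) 0 = 0.
    by rewrite mxE mixed_direction_rest // mulr0.
  rewrite rotation_laplacian_rest //; apply: circ0 => j.
  by rewrite mixed_direction_rest.
Qed.

End Instability.

(** * Bandwidth conditions *)

Section Bandwidth.
Context {R : realType}.
Variable n : nat.
Local Notation N := n.+1.
Local Notation theta := (step_angle N).
Implicit Types (w : 'M[R]_N) (gamma : nat -> R) (s : 'I_N).

Lemma ord_dist_bounds s : s != 0 -> (1 <= minn s (N - s) <= N./2)%N.
Proof.
rewrite -val_eqE /= => s0; have := ltn_ord s; have := odd_double_half N.
by case: (odd N) => /=; lia.
Qed.

Lemma twist_mode_dist (m : nat) s :
  twist_mode theta m s = twist_mode theta m (minn s (N - s)) :> R.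
Proof.
have sN := ltn_ord s; rewrite /minn; case: ltnP => // _.
have opp k : cos ((k * s)%:R * theta) = cos ((k * (N - s))%:R * theta) :> R.
  rewrite (@cos_sin_step_opp _ N (k * s) (k * (N - s))) //.
  by rewrite -mulnDr subnKC ?dvdn_mull // ltnW.
by rewrite /twist_mode !opp; have := opp 1%N; rewrite !mul1n => ->.
Qed.

Lemma cos_dist s : cos (s%:R * theta) = cos ((minn s (N - s))%:R * theta) :> R.
Proof.
have sN := ltn_ord s; rewrite /minn; case: ltnP => // _.
by rewrite (@cos_sin_step_opp _ N s (N - s)) // subnKC // ltnW.
Qed.

Lemma offset_weight_inord gamma k : (1 <= k <= N./2)%N ->
  offset_weight gamma (inord k : 'I_N) = gamma k.
Proof.
move=> /andP[k1 k2]; have h := odd_double_half N.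
have kN : (k < N)%N by case: (odd N) h => /=; lia.
rewrite /offset_weight -val_eqE /= inordK // eqn0Ngt k1 /=; congr gamma.
by case: (odd N) h => /=; lia.
Qed.

Lemma gamma_ge0 w gamma k : symmetric_circulant w gamma ->
  (1 <= k <= N./2)%N -> 0 <= gamma k.
Proof.
by move=> wc kN; rewrite -(offset_weight_inord _ kN) (offset_weight_ge0 _ wc).
Qed.

(** For offsets of cyclic distance less than [N / 4] the cosine is nonnegative,
    so only the mixed entries can destabilize. *)
Lemma bandwidth_twist_stable e w gamma K (T : 'M[R]_e.+2) :
  symmetric_circulant w gamma -> bandwidth N gamma K -> (4 * K < N)%N ->
  (forall m : nat, \sum_(s < N) offset_weight gamma s * twist_mode theta m s <= 0) ->
  twist_generator N T -> linearly_stable w (one_twist N T).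
Proof.
move=> wc bw KN modes Tg; apply: (twist_stable_of_modes wc Tg _ modes) => s.
rewrite /offset_weight; case: eqVneq => [_|s0]; first by rewrite mul0r.
have kN := ord_dist_bounds s0; rewrite cos_dist; move: (minn _ _) kN => k kN.
have [Kk|kK] := ltnP K k; first by rewrite bw // mul0r.
by rewrite mulr_ge0 ?(gamma_ge0 wc kN) // cos_step_ge0 //; lia.
Qed.

Lemma strict_bandwidth_bandwidth gamma K :
  strict_bandwidth N gamma K -> bandwidth N gamma K.
Proof. by move=> sb k kN Kk; apply: sb => //; rewrite gtn_eqF. Qed.

Lemma strict_bandwidth_stable e w gamma K (T : 'M[R]_e.+2) :
  symmetric_circulant w gamma -> strict_bandwidth N gamma K ->
  (0 < K)%N -> (K %| N)%N -> (4 * K < N)%N ->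
  twist_generator N T -> linearly_stable w (one_twist N T).
Proof.
move=> wc sb K0 KdN KN.
apply: (bandwidth_twist_stable wc (strict_bandwidth_bandwidth sb) KN) => m.
apply: sumr_le0 => s _; rewrite /offset_weight.
case: eqVneq => [_|s0]; first by rewrite mul0r.
have kN := ord_dist_bounds s0; rewrite twist_mode_dist.
move: (minn _ _) kN => k kN; have [->|kK] := eqVneq k K; last by rewrite sb // mul0r.
rewrite mulr_ge0_le0 ?twist_mode_dvd //.
by apply: (gamma_ge0 wc); have := odd_double_half N; case: (odd N) => /=; lia.
Qed.

(** All offsets that carry weight are at distance [K] and share the same value
    of the twist mode, so one positive mode suffices. *)
Lemma strict_bandwidth_unstable e w gamma K (T : 'M[R]_e.+3) :
  symmetric_circulant w gamma -> not_all_zero N gamma ->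
  strict_bandwidth N gamma K -> (1 <= K <= N./2)%N -> ~ (K %| N)%N ->
  twist_generator N T -> linearly_unstable w (one_twist N T).
Proof.
move=> wc [k0 [k0N gk0]] sb KN KndN Tg.
have gK : 0 < gamma K.
  rewrite lt_neqAle (gamma_ge0 wc KN) andbT eq_sym.
  by move: gk0; have [->|/(sb _ k0N)->] := eqVneq k0 K; rewrite ?eqxx.
have [m mode] := exists_twist_mode_gt0 (R := R) KN KndN.
apply: (twist_unstable_of_mode (m := m) wc Tg).
have sK : (minn (inord K : 'I_N) (N - (inord K : 'I_N)) = K)%N.
  have h := odd_double_half N; rewrite inordK; case: (odd N) h => /=; lia.
rewrite (bigD1 (inord K)) //= offset_weight_inord // twist_mode_dist sK.
rewrite ltr_wpDr ?mulr_gt0 //; apply: sumr_ge0 => s _.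
rewrite /offset_weight; case: eqVneq => [_|s0]; first by rewrite mul0r.
have kN := ord_dist_bounds s0; rewrite twist_mode_dist.
move: (minn _ _) kN => k kN; have [->|kK] := eqVneq k K; last by rewrite sb // mul0r.
by rewrite mulr_ge0 // ltW.
Qed.

(** In a mode that is not neutral, the edges of length 1 contribute at most
    [- gamma_1 * mode_gap N], whereas a longer edge contributes at most 4 times
    its weight, and there are at most [N] such offsets. *)
Lemma strong_local_coupling_stable e w gamma K (T : 'M[R]_e.+2) :
  symmetric_circulant w gamma -> bandwidth N gamma K ->
  (1 <= K)%N -> (4 * K < N)%N ->
  4 * N%:R / mode_gap N * (\sum_(i < K.-1) gamma i.+2) < gamma 1%N ->
  twist_generator N T -> linearly_stable w (one_twist N T).
Proof.
move=> wc bw K1 KN; set S := \sum_(i < _) _ => strong.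
have N0 : (0 < N)%N by [].
apply: (bandwidth_twist_stable wc bw KN) => m.
have inrange k : (0 < k <= K)%N -> (1 <= k <= N./2)%N.
  by have := odd_double_half N; case: (odd N) => /=; lia.
have S0 : 0 <= S.
  apply: sumr_ge0 => i _; apply: (gamma_ge0 wc); apply: inrange.
  by have := ltn_ord i; lia.
have gap0 : 0 < mode_gap N :> R by apply: mode_gap_gt0; lia.
have gapS : 4 * N%:R * S < gamma 1%N * mode_gap N.
  by rewrite -ltr_pdivrMr // mulrAC.
(* In the neutral modes every term of the sum vanishes. *)
have [edge|inner] := boolP ((m %% N == 0) || (m %% N == n))%N.
  rewrite big1 // => s _; rewrite -(twist_mode_mod _ N0 (modn_mod m N)).
  by rewrite twist_mode_edge ?mulr0 //; case/orP: edge => /eqP; [left|right].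
(* Only the term [s = 1] is needed to beat the others, each at most [4 S]. *)
have term s : offset_weight gamma s * twist_mode theta m s <= 4 * S.
  rewrite /offset_weight; case: eqVneq => [_|s0]; first by rewrite mul0r mulr_ge0.
  have kN := ord_dist_bounds s0; rewrite twist_mode_dist.
  move: (minn _ _) kN => k kN; have g0 := gamma_ge0 wc kN.
  have [Kk|kK] := ltnP K k; first by rewrite bw // mul0r mulr_ge0.
  have [->|k1] := eqVneq k 1%N.
    apply: le_trans (_ : 0 <= _); last by rewrite mulr_ge0.
    rewrite mulr_ge0_le0 ?twist_mode1_le0 //; last lia.
    by apply: (gamma_ge0 wc); apply: inrange; lia.
  apply: le_trans (_ : gamma k * 4 <= _).
    by rewrite ler_wpM2l // twist_mode_le4.
  have kK2 : (k - 2 < K.-1)%N by lia.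
  rewrite mulrC ler_wpM2l // /S (bigD1 (Ordinal kK2)) //=.
  have -> : (k - 2).+2 = k by lia.
  rewrite lerDl; apply: sumr_ge0 => i _; apply: (gamma_ge0 wc); apply: inrange.
  by have := ltn_ord i; lia.
rewrite (bigD1 (inord 1)) //= offset_weight_inord; last by apply: inrange; lia.
have first : gamma 1%N * twist_mode theta m (inord 1 : 'I_N) <=
    - (gamma 1%N * mode_gap N).
  rewrite -mulrN ler_wpM2l //; first by apply: (gamma_ge0 wc); apply: inrange; lia.
  rewrite inordK; last lia.
  have mN : (m %% N < N)%N by rewrite ltn_pmod.
  rewrite (twist_mode_mod _ N0 (esym (modn_mod m N))) twist_mode1_gap //; lia.
have rest : \sum_(s < N | s != inord 1) offset_weight gamma s * twist_mode theta m s
    <= 4 * N%:R * S.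
  apply: le_trans (ler_sum _ (fun s _ => term s)) _.
  apply: le_trans (_ : \sum_(s < N) 4 * S <= _).
    rewrite [leRHS](bigID (fun s => s != inord 1)) /= lerDl sumr_ge0 // => *.
    by rewrite mulr_ge0.
  by rewrite sumr_const card_ord -[_ *+ _]mulr_natr mulrAC.
lra.
Qed.

End Bandwidth.

Lemma plane_rotation_generator (R : realType) n e :
  twist_generator n (plane_rotation e.+2 (step_angle n) : 'M[R]_e.+2).
Proof.
split; first exact: plane_rotation_special.
exists 1%:M; split; first by rewrite /orthogonal_mx trmx1 mulmx1.
by rewrite trmx1 mulmx1 mul1mx.
Qed.

Lemma linear_piecewise_linear (R : realType) m (a : 'rV[R]_m) :
  piecewise_linear (fun x => (a *m x) 0 0).
Proof.
exists 1%N, (fun _ _ => True), (fun _ => a), (fun _ => 0); split=> [_|x|_ x _].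
- by exists 0%N, 0, 0 => x; split=> // _ [].
- by exists 0.
- by rewrite addr0.
Qed.

Theorem theorem2p17 (R : realType) (n : nat) :
  (forall (d : nat) (w : 'M[R]_n) (gamma : nat -> R),
     (3 <= d)%N -> symmetric_circulant w gamma -> not_all_zero n gamma ->
     (bandwidth n gamma 1 -> (4 * 1 < n)%N -> supports_one_twists d w) /\
     (forall K : nat, (1 <= K <= n./2)%N -> strict_bandwidth n gamma K ->
        (~ (K %| n)%N ->
           (forall T : 'M[R]_d, twist_generator n T ->
              linearly_unstable w (one_twist n T)) /\
           ~ supports_one_twists d w) /\
        ((K %| n)%N -> (4 * K < n)%N ->
           forall T : 'M[R]_d, twist_generator n T ->
             linearly_stable w (one_twist n T)))) /\
  (forall K : nat, (1 <= K)%N -> (4 * K < n)%N ->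
     exists G : 'cV[R]_(K.-1) -> R,
       piecewise_linear G /\
       forall (d : nat) (w : 'M[R]_n) (gamma : nat -> R),
         (3 <= d)%N -> symmetric_circulant w gamma -> bandwidth n gamma K ->
         G (\col_(i < K.-1) gamma i.+2) < gamma 1%N ->
         supports_one_twists d w).
Proof.
case: n => [|n].
  by split=> [d w gamma _ _ _|K _]; [split=> // -[|K] /andP[] | rewrite ltn0].
split=> [d w gamma d3 wc gn0|K K1 KN]; last first.
  exists (fun x => ((const_mx (4 * n.+1%:R / mode_gap n.+1) : 'rV[R]_(K.-1)) *m x) 0 0).
  split; first exact: linear_piecewise_linear.
  move=> [|[|d]] w gamma // _ wc bw strong T.
  apply: (strong_local_coupling_stable wc bw K1 KN).
  move: strong; rewrite mxE mulr_sumr.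
  by under eq_bigr do rewrite !mxE.
case: d d3 => [|[|[|d]]] // _; split=> [bw n4 T|K KN sb].
  apply: (strict_bandwidth_stable wc (K := 1)) => // k kN k1.
  by apply: bw => //; lia.
split=> [KndN|KdN KN4 T]; last first.
  by apply: (strict_bandwidth_stable wc sb) => //; case/andP: KN.
have unstable (T : 'M[R]_d.+3) :
    twist_generator n.+1 T -> linearly_unstable w (one_twist n.+1 T).
  by move=> Tg; exact: (strict_bandwidth_unstable wc gn0 sb KN KndN Tg).
split=> // stable.
have gen := plane_rotation_generator R n.+1 d.+1.
by have [a [/(stable _ gen)]] := unstable _ gen.
Qed.
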